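(* For any $\epsilon>0$ there is $N=N(\epsilon)$ such that for every $n>N(\epsilon)$ there is an explicit construction of a $3$-write binary WOM code of length $n$ that has rate larger than $1.809-\epsilon$.
   Context: All logarithms are base $2$. For two vectors $y,y'\in\{0,1\}^n$ we write $y'\le y$ if $y'_i\le y_i$ for every coordinate $i$. A $3$-write binary WOM (write-once-memory) code of length $n$ over finite message sets $\Omega_1,\Omega_2,\Omega_3$ consists of encoding functions $E_1:\Omega_1\to\{0,1\}^n$, $E_2:\mathrm{Im}(E_1)\times\Omega_2\to\{0,1\}^n$, $E_3:\mathrm{Im}(E_2)\times\Omega_3\to\{0,1\}^n$ and decoding functions $D_i:\mathrm{Im}(E_i)\to\Omega_i$ for $i=1,2,3$, such that: $D_1(E_1(x))=x$ for all $x\in\Omega_1$; and for $i=2,3$, for every $w\in\mathrm{Im}(E_{i-1})$ and every $x\in\Omega_i$, we have $w\le E_i(w,x)$ and $D_i(E_i(w,x))=x$. The rate of the code is $(\log|\Omega_1|+\log|\Omega_2|+\log|\Omega_3|)/n$. ''Explicit'' means that the encoding and decoding functions are given by a deterministic algorithm, uniform in $n$. It is implicitly assumed that the decoder knows in which of the rounds a given memory word was written. *)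

(* Defs.v *)
From mathcomp Require Import all_boot all_order all_algebra.
From mathcomp Require Import reals exp.

Set Implicit Arguments.
Unset Strict Implicit.
Unset Printing Implicit Defensive.

(** * Write-once-memory codes *)

Notation word n := (n.-tuple bool).

Definition word_le n (y' y : word n) : bool :=
  [forall i, tnth y' i ==> tnth y i].

(* Im(f) as a type, so that E_2, E_3 and the D_i have the domains of the
   definition and not all of {0,1}^n. *)
Definition image_of n (T : finType) (f : T -> word n) : finType :=
  {w : word n | w \in codom f}.

Definition to_image n (T : finType) (f : T -> word n) (t : T) : image_of f :=
  exist _ (f t) (codom_f f t).

(* The message sets have to be nonempty for the logarithms in the rate to make
   sense: [ln 0 = 0] by convention, and if [Omega1] were empty then so would be
   the domain of [enc2], and [Omega2] could be arbitrarily large. *)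
Record wom3_code (n : nat) (Omega1 Omega2 Omega3 : finType) : Type := WOM3Code {
  enc1 : Omega1 -> word n;
  enc2 : image_of enc1 * Omega2 -> word n;
  enc3 : image_of enc2 * Omega3 -> word n;
  dec1 : image_of enc1 -> Omega1;
  dec2 : image_of enc2 -> Omega2;
  dec3 : image_of enc3 -> Omega3;
  Omega1_gt0 : 0 < #|Omega1|;
  Omega2_gt0 : 0 < #|Omega2|;
  Omega3_gt0 : 0 < #|Omega3|;
  enc1K : forall x, dec1 (to_image enc1 x) = x;
  enc2_le : forall w x, word_le (val w) (enc2 (w, x));
  enc2K : forall w x, dec2 (to_image enc2 (w, x)) = x;
  enc3_le : forall w x, word_le (val w) (enc3 (w, x));
  enc3K : forall w x, dec3 (to_image enc3 (w, x)) = x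
}.

Arguments enc1 {n Omega1 Omega2 Omega3} C _ : rename.
Arguments enc2 {n Omega1 Omega2 Omega3} C _ : rename.
Arguments enc3 {n Omega1 Omega2 Omega3} C _ : rename.
Arguments dec1 {n Omega1 Omega2 Omega3} C _ : rename.
Arguments dec2 {n Omega1 Omega2 Omega3} C _ : rename.
Arguments dec3 {n Omega1 Omega2 Omega3} C _ : rename.

Definition log2 (R : realType) (x : R) : R := (ln x / ln 2)%R.

Definition rate (R : realType) n (Omega1 Omega2 Omega3 : finType)
    (C : wom3_code n Omega1 Omega2 Omega3) : R :=
  ((log2 #|Omega1|%:R + log2 #|Omega2|%:R + log2 #|Omega3|%:R) / n%:R)%R.

(** * Algorithms: Kleene's partial recursive functions *)

(* Arities are not tracked: a program is run on a list of arguments, and a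
   projection beyond the end of the list reads as 0. *)
Inductive recf : Type :=
| Zero
| Succ
| Proj of nat
| Comp of recf & seq recf
| Prec of recf & recf
| Mu of recf.

(* [evals f xs y]: the program [f] run on [xs] halts with the value [y]. *)
Inductive evals : recf -> seq nat -> nat -> Prop :=
| evals_zero xs : evals Zero xs 0
| evals_succ xs : evals Succ xs (nth 0 xs 0).+1
| evals_proj i xs : evals (Proj i) xs (nth 0 xs i)
| evals_comp f gs xs ys z :
    evals_seq gs xs ys -> evals f ys z -> evals (Comp f gs) xs z
| evals_prec0 f g xs y : evals f xs y -> evals (Prec f g) (0 :: xs) y
| evals_precS f g k xs y z :
    evals (Prec f g) (k :: xs) y -> evals g [:: k, y & xs] z ->
    evals (Prec f g) (k.+1 :: xs) z
| evals_mu f xs k :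
    (forall j, j < k -> exists v, evals f (j :: xs) v.+1) ->
    evals f (k :: xs) 0 -> evals (Mu f) xs k
with evals_seq : seq recf -> seq nat -> seq nat -> Prop :=
| evals_nil xs : evals_seq [::] xs [::]
| evals_cons g gs xs y ys :
    evals g xs y -> evals_seq gs xs ys -> evals_seq (g :: gs) xs (y :: ys).

(** * Explicit families of codes *)

(* The number with binary digits [w], least significant first. *)
Definition word_num n (w : word n) : nat := \sum_(i < n) tnth w i * 2 ^ i.

(* The programs take the length [n] as their first argument. *)
Record wom3_algorithm : Type := WOM3Algorithm {
  alg_size1 : recf; alg_size2 : recf; alg_size3 : recf;
  alg_enc1 : recf; alg_enc2 : recf; alg_enc3 : recf;
  alg_dec1 : recf; alg_dec2 : recf; alg_dec3 : recf
}.

(* Messages are numbers, and the domain of each function is part of what is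
   computed: the sizes of the message sets are outputs of the algorithm. *)
Record computes_code (A : wom3_algorithm) n m1 m2 m3
    (C : wom3_code n 'I_m1 'I_m2 'I_m3) : Prop := ComputesCode {
  computes_size1 : evals (alg_size1 A) [:: n] m1;
  computes_size2 : evals (alg_size2 A) [:: n] m2;
  computes_size3 : evals (alg_size3 A) [:: n] m3;
  computes_enc1 : forall x : 'I_m1,
    evals (alg_enc1 A) [:: n; val x] (word_num (enc1 C x));
  computes_enc2 : forall (w : image_of (enc1 C)) (x : 'I_m2),
    evals (alg_enc2 A) [:: n; word_num (val w); val x]
      (word_num (enc2 C (w, x)));
  computes_enc3 : forall (w : image_of (enc2 C)) (x : 'I_m3),
    evals (alg_enc3 A) [:: n; word_num (val w); val x]
      (word_num (enc3 C (w, x)));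
  computes_dec1 : forall w : image_of (enc1 C),
    evals (alg_dec1 A) [:: n; word_num (val w)] (val (dec1 C w));
  computes_dec2 : forall w : image_of (enc2 C),
    evals (alg_dec2 A) [:: n; word_num (val w)] (val (dec2 C w));
  computes_dec3 : forall w : image_of (enc3 C),
    evals (alg_dec3 A) [:: n; word_num (val w)] (val (dec3 C w))
}.

(* Main.v *)
(* Take n = 4m and let the memory have weight m after the first write, 2m after
   the second, and be arbitrary after the third. A random coloring of the words
   with slightly fewer colors than a state has successors shows every color
   above every state, so it can serve as decoder. The rates of the three writes
   add up to log (C(4m, m) C(3m, m) 2^(2m)) / n - O(log n / n), and comparing
   with the largest terms of (1 + 3)^(4m) and (1 + 2)^(3m) shows that this is
   2 - O(log n / n), hence it exceeds 1.809 for m = 64. This single code of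
   length 256 is a finite table; for arbitrary n the memory is cut into
   n %/ 256 blocks and the table is applied to each base 2^256 digit, which is
   primitive recursive. *)
Require Import Defs.
From mathcomp Require Import all_boot all_order all_algebra.
From mathcomp Require Import reals exp.
From mathcomp Require Import zify ring lra.

Set Implicit Arguments.
Unset Strict Implicit.
Unset Printing Implicit Defensive.

(** * Computable functions *)

(** Only lists of length [k] are constrained: with a known arity all arguments can be copied by the
    projections [0] to [k - 1]. *)
Definition computable k (F : seq nat -> nat) :=
  exists f, forall xs, size xs = k -> evals f xs (F xs).

Lemma computable_eq k F G :
  computable k F -> (forall xs, size xs = k -> F xs = G xs) -> computable k G.
Proof. by case=> f Ff FG; exists f => xs xsk; rewrite -FG//; apply: Ff. Qed.

Lemma computable_nth k i : computable k (fun xs => nth 0 xs i).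
Proof. by exists (Proj i) => xs _; constructor. Qed.

Lemma computable_succ k F : computable k F -> computable k (fun xs => (F xs).+1).
Proof.
case=> f Ff; exists (Comp Succ [:: f]) => xs xsk.
apply: (@evals_comp _ _ _ [:: F xs]); last exact: (evals_succ [:: F xs]).
by constructor; [exact: Ff | constructor].
Qed.

Lemma computable_const k c : computable k (fun=> c).
Proof.
elim: c => [|c IHc]; last exact: computable_succ.
by exists Zero => xs _; constructor.
Qed.

Lemma evals_seq_proj ns xs :
  evals_seq [seq Proj i | i <- ns] xs [seq nth 0 xs i | i <- ns].
Proof. by elim: ns => [|i s IHs] /=; constructor => //; constructor. Qed.

Lemma computable_reindex k l F ns : size ns = k -> computable k F ->
  computable l (fun xs => F [seq nth 0 xs i | i <- ns]).
Proof.
move=> nsk [f Ff]; exists (Comp f [seq Proj i | i <- ns]) => xs _.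
apply: evals_comp (evals_seq_proj _ _) _.
by apply: Ff; rewrite size_map.
Qed.

(** [Prec] recurses on the head of its list, so the count [N xs] is put in front and [xs] is copied
    behind it by projections. *)
Lemma computable_iteri k N F G :
  computable k N -> computable k F -> computable k.+2 G ->
  computable k (fun xs => iteri (N xs) (fun i y => G [:: i, y & xs]) (F xs)).
Proof.
move=> [n Nn] [f Ff] [g Gg].
exists (Comp (Prec f g) (n :: [seq Proj i | i <- iota 0 k])) => xs xsk.
apply: (@evals_comp _ _ _ (N xs :: xs)).
  constructor; first exact: Nn.
  rewrite -{2}(mkseq_nth 0 xs) xsk; exact: evals_seq_proj.
elim: (N xs) => [|m IHm] /=; first by constructor; exact: Ff.
by apply: evals_precS IHm _; apply: Gg; rewrite /= xsk.
Qed.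

Lemma computable_behead k F : computable k F -> computable k.+1 (F \o behead).
Proof.
move=> cF; have := @computable_reindex _ k.+1 _ (iota 1 k) (size_iota 1 k) cF.
move/computable_eq; apply=> -[//|x xs] [xsk] /=; congr F.
by rewrite -[RHS](mkseq_nth 0) xsk (iotaDl 1 0) -map_comp.
Qed.

Lemma computable_add k F G : computable k F -> computable k G ->
  computable k (fun xs => F xs + G xs).
Proof.
move=> cF cG.
have := computable_iteri cF cG (computable_succ (computable_nth k.+2 1)).
move/computable_eq; apply=> xs _ /=.
by elim: (F xs) => //= m ->; rewrite addSn.
Qed.

Lemma computable_mul k F G : computable k F -> computable k G ->
  computable k (fun xs => F xs * G xs).
Proof.
move=> cF cG.
have := computable_iteri cF (computable_const k 0) (computable_add
  (computable_behead (computable_behead cG)) (computable_nth k.+2 1)).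
move/computable_eq; apply=> xs _ /=.
by elim: (F xs) => //= m ->; rewrite mulSn.
Qed.

Lemma computable_exp k F G : computable k F -> computable k G ->
  computable k (fun xs => F xs ^ G xs).
Proof.
move=> cF cG.
have := computable_iteri cG (computable_const k 1) (computable_mul
  (computable_behead (computable_behead cF)) (computable_nth k.+2 1)).
move/computable_eq; apply=> xs _ /=.
by elim: (G xs) => //= m ->; rewrite expnS.
Qed.

Lemma computable_pred k F : computable k F -> computable k (fun xs => (F xs).-1).
Proof.
move=> cF.
have := computable_iteri cF (computable_const k 0) (computable_nth k.+2 0).
by move/computable_eq; apply=> xs _ /=; case: (F xs).
Qed.

Lemma computable_sub k F G : computable k F -> computable k G ->
  computable k (fun xs => F xs - G xs).
Proof.
move=> cF cG.
have := computable_iteri cG cF (computable_pred (computable_nth k.+2 1)).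
move/computable_eq; apply=> xs _ /=.
by elim: (G xs) => /= [|m ->]; rewrite ?subn0// subnS.
Qed.

Lemma computable_sum k N F : computable k N -> computable k.+1 F ->
  computable k (fun xs => \sum_(i < N xs) F (val i :: xs)).
Proof.
move=> cN cF.
have cF' := computable_reindex k.+2 _ cF.
(* The positions [0 :: iota 2 k] skip the accumulator, which sits at position 1. *)
have/cF' : size (0 :: iota 2 k) = k.+1 by rewrite /= size_iota.
move/(computable_add (computable_nth k.+2 1))=> {}cF'.
have := computable_iteri cN (computable_const k 0) cF'.
move/computable_eq; apply=> xs xsk /=.
have E i y : [seq nth 0 [:: i, y & xs] j | j <- iota 2 k] = xs.
  by rewrite -[RHS](mkseq_nth 0) xsk (iotaDl 2 0) -map_comp.
elim: (N xs) => /= [|m ->]; first by rewrite big_ord0.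
by rewrite E big_ord_recr.
Qed.

(** The quotient is the number of [j < F xs] with [j.+1 * G xs <= F xs]; truncated subtraction gives
    the indicator of this condition. *)
Lemma computable_div k F G : (forall xs, 0 < G xs) ->
  computable k F -> computable k G -> computable k (fun xs => F xs %/ G xs).
Proof.
move=> G0 cF cG.
have := computable_sum cF (computable_sub (computable_const k.+1 1)
  (computable_sub (computable_mul (computable_succ (computable_nth k.+1 0))
     (computable_behead cG)) (computable_behead cF))).
move/computable_eq; apply=> xs _ /=.
have E j : 1 - (j.+1 * G xs - F xs) = (j < F xs %/ G xs).
  by rewrite leq_divRL// -subn_eq0; case: (_ * _ - _).
have : F xs %/ G xs <= F xs by exact: leq_div.
under eq_bigr do rewrite E.
elim: (F xs) (_ %/ _) => {E} [|n IHn] q; first by rewrite big_ord0; case: q.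
rewrite leq_eqVlt => /predU1P[->|]; rewrite big_ord_recr /=.
  rewrite ltnSn addn1; congr _.+1; rewrite -[RHS](IHn n)//.
  by apply: eq_bigr => i _; rewrite ltnS ltn_ord ltnW.
by rewrite ltnS => qn; rewrite IHn// ltnNge qn addn0.
Qed.

Lemma computable_mod k F G : (forall xs, 0 < G xs) ->
  computable k F -> computable k G -> computable k (fun xs => F xs %% G xs).
Proof.
move=> G0 cF cG.
have := computable_sub cF (computable_mul (computable_div G0 cF cG) cG).
by move/computable_eq; apply=> xs _; rewrite {1}(divn_eq (F xs) (G xs)) addKn.
Qed.

(** Iteration serves as case distinction: the last step ignores the accumulator and looks up the
    predecessor index in the tail. This is how finite objects become programs. *)
Lemma computable_table k s F :
  computable k F -> computable k (fun xs => nth 0 s (F xs)).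
Proof.
elim: s k F => [|a s IHs] k F cF.
  by apply: computable_eq (computable_const k 0) _ => xs _; rewrite nth_nil.
have := computable_iteri cF (computable_const k a)
  (IHs _ _ (computable_nth k.+2 0)).
by move/computable_eq; apply=> xs _ /=; case: (F xs).
Qed.

(** Bounded arguments meet only finitely many values of [f], so an arbitrary [f] becomes a table,
    with pairs indexed in base [b]. *)
Lemma computable_table2 k (f : nat -> nat -> nat) a b F G :
    (forall xs, F xs < a) -> (forall xs, G xs < b) ->
    computable k F -> computable k G ->
  computable k (fun xs => f (F xs) (G xs)).
Proof.
move=> Fa Gb cF cG.
have := computable_table (mkseq (fun z => f (z %/ b) (z %% b)) (a * b))
  (computable_add (computable_mul cF (computable_const k b)) cG).
move/computable_eq; apply=> xs _.
have b0 : 0 < b by apply: leq_trans (Gb xs).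
rewrite nth_mkseq.
  by rewrite divnMDl// divn_small// addn0 modnMDl modn_small.
have := Fa xs; have := Gb xs; nia.
Qed.

(** * Digits *)

Definition digit D x j := x %/ D ^ j %% D.

Definition from_digits D q (F : nat -> nat) := \sum_(j < q) F j * D ^ j.

Lemma from_digits_lt D q F : 0 < D ->
  (forall j, j < q -> F j < D) -> from_digits D q F < D ^ q.
Proof.
rewrite /from_digits => D0; elim: q => [|q IHq] FD; first by rewrite big_ord0.
rewrite big_ord_recr /= expnS.
have /IHq : forall j, j < q -> F j < D by move=> j jq; apply: FD; lia.
have := FD q (ltnSn q); move: (\sum_(i < q) _) (D ^ q) (F q); nia.
Qed.

Lemma from_digits_recl D q F :
  from_digits D q.+1 F = F 0 + from_digits D q (F \o succn) * D.
Proof.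
rewrite /from_digits big_ord_recl expn0 muln1 big_distrl; congr (_ + _).
by apply: eq_bigr => i _; rewrite /= expnSr mulnA.
Qed.

Lemma digitS D x j : digit D x j.+1 = digit D (x %/ D) j.
Proof. by rewrite /digit expnS divnMA. Qed.

Lemma from_digitsK D q F j : (forall j, j < q -> F j < D) -> j < q ->
  digit D (from_digits D q F) j = F j.
Proof.
elim: q F j => [//|q IHq] F j FD jq; have F0 := FD 0 (ltn0Sn q).
have D0 : 0 < D by apply: leq_trans F0.
rewrite from_digits_recl; case: j jq => [|j] jq.
  by rewrite /digit divn1 addnC modnMDl modn_small.
rewrite digitS addnC divnMDl// divn_small// addn0 IHq// => i iq.
exact: FD.
Qed.

Lemma digitK D q x : x < D ^ q -> from_digits D q (digit D x) = x.
Proof.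
elim: q x => [|q IHq] x xD.
  by rewrite /from_digits big_ord0; case: x xD.
have D0 : 0 < D by case: (D) xD; rewrite ?exp0n.
rewrite from_digits_recl {1}/digit divn1 [RHS](divn_eq x D) addnC.
congr (_ * _ + _); rewrite -[RHS]IHq; last by rewrite ltn_divLR// -expnSr.
by apply: eq_bigr => i _; rewrite /= digitS.
Qed.

(** All encoders and decoders come from here: an arbitrary block function is a table lookup for each
    digit, while the number of digits varies with the input. *)
Lemma computable_map_digits k (f : nat -> nat -> nat) a b d N F G :
    0 < a -> 0 < b -> computable k N -> computable k F -> computable k G ->
  computable k (fun xs => from_digits d (N xs)
    (fun j => f (digit a (F xs) j) (digit b (G xs) j))).
Proof.
move=> a0 b0 cN cF cG; pose p := fun xs => nth 0 xs 0.
have cp : computable k.+1 p by exact: computable_nth.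
have cdigit c H : 0 < c -> computable k H ->
    computable k.+1 (fun xs => digit c (H (behead xs)) (p xs)).
  move=> c0 cH; apply: computable_mod => //; last exact: computable_const.
  apply: computable_div; first by move=> xs; rewrite expn_gt0 c0.
    exact: computable_behead.
  by apply: computable_exp cp; exact: computable_const.
apply: (@computable_sum _ _ (fun xs =>
  f (digit a (F (behead xs)) (p xs)) (digit b (G (behead xs)) (p xs))
    * d ^ p xs)) => //.
apply: computable_mul; last first.
  by apply: computable_exp cp; exact: computable_const.
apply: (@computable_table2 _ f a b _ _ _ _ (cdigit _ _ a0 cF) (cdigit _ _ b0 cG)).
- by move=> xs; rewrite ltn_mod.
- by move=> xs; rewrite ltn_mod.
Qed.

(** * Words as binary numbers *)

Definition num_word n x : word n := [tuple odd (x %/ 2 ^ i) | i < n].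

Lemma word_numE n (w : word n) : word_num w = from_digits 2 n (nth false w).
Proof. by apply: eq_bigr => i _; rewrite (tnth_nth false). Qed.

Lemma word_num_lt n (w : word n) : word_num w < 2 ^ n.
Proof. by rewrite word_numE from_digits_lt// => j _; case: nth. Qed.

Lemma digit2 x j : digit 2 x j = odd (x %/ 2 ^ j).
Proof. exact: modn2. Qed.

Lemma word_numK n : cancel (@word_num n) (num_word n).
Proof.
move=> w; apply: eq_from_tnth => i; rewrite tnth_mktuple word_numE.
apply: (can_inj oddb); rewrite -digit2 from_digitsK// ?(tnth_nth false)//.
by move=> j _; case: nth.
Qed.

Lemma num_wordK n x : x < 2 ^ n -> word_num (num_word n x) = x.
Proof.
move=> x2n; rewrite /word_num -[RHS](digitK x2n).
by apply: eq_bigr => i _; rewrite tnth_mktuple digit2.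
Qed.

Lemma word_le_num n x y :
  reflect (forall i, i < n -> odd (x %/ 2 ^ i) -> odd (y %/ 2 ^ i))
    (word_le (num_word n x) (num_word n y)).
Proof.
apply: (iffP forallP) => [xy i ni|xy i]; last first.
  by rewrite !tnth_mktuple; apply/implyP/xy.
by have := xy (Ordinal ni); rewrite !tnth_mktuple => /implyP.
Qed.

(** Bit [i] of a word is bit [i %% m] of digit [i %/ m]. The bound on [x] clears its bits beyond the
    [q] blocks, so leftover cells are harmless. *)
Lemma word_le_digits n m q x y : x < (2 ^ m) ^ q ->
  (forall j, j < q -> word_le (num_word m (digit (2 ^ m) x j))
                              (num_word m (digit (2 ^ m) y j))) ->
  word_le (num_word n x) (num_word n y).
Proof.
have odd_digit z j r : r < m ->
    odd (digit (2 ^ m) z j %/ 2 ^ r) = odd (z %/ 2 ^ (j * m + r)).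
  move=> rm; apply: (can_inj oddb); rewrite -!modn2 /digit.
  (* Splitting [2 ^ m] lets the division by [2 ^ r] pass through the remainder; parity survives
     since [2 ^ (m - r)] is even. *)
  rewrite [X in _ %% X %/ _](_ : _ = 2 ^ (m - r) * 2 ^ r); last first.
    by rewrite -expnD subnK// ltnW.
  rewrite -modn_divl modn_dvdm; last by rewrite -{1}[2]expn1 dvdn_exp2l// subn_gt0.
  by rewrite expnD divnMA -expnM mulnC.
move=> xq xy; apply/word_le_num => i _.
have [m0|m0] := posnP m.
  by rewrite m0 exp1n in xq; case: x xq {xy} => //; rewrite div0n.
rewrite (divn_eq i m) -!odd_digit ?ltn_mod//.
have [iq|qi] := ltnP (i %/ m) q.
  by move/word_le_num: (xy _ iq); apply; rewrite ltn_mod.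
rewrite /digit (@divn_small x) ?mod0n ?div0n//.
by apply: leq_trans xq _; rewrite leq_exp2l// -{1}(expn0 2) ltn_exp2l.
Qed.

(** * Repetition of a block code *)

(* [E w x] writes the message [x < M] over the memory state [w], [D] reads it
   back; [P] and [Q] are the sets of states before and after the write. *)
Definition is_write m M (P Q : pred (word m)) (E : nat -> nat -> nat) D :=
  forall w x, P (num_word m w) -> x < M ->
  [/\ Q (num_word m (E w x)), word_le (num_word m w) (num_word m (E w x))
    & D (E w x) = x].

(** The bound says that nothing is stored beyond the [q] blocks. *)
Definition all_digits m q (P : pred (word m)) w :=
  w < (2 ^ m) ^ q /\ forall j, j < q -> P (num_word m (digit (2 ^ m) w j)).

Definition rep_enc m M q (E : nat -> nat -> nat) w x :=
  from_digits (2 ^ m) q (fun j => E (digit (2 ^ m) w j) (digit M x j)).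

Definition rep_dec m M q (D : nat -> nat) w :=
  from_digits M q (fun j => D (digit (2 ^ m) w j)).

(** The write acts on each block separately, and the resulting state again satisfies [all_digits],
    so successive writes can be chained. *)
Lemma is_write_rep n m M q (P Q : pred (word m)) E D w x :
    is_write M P Q E D -> (forall w x, E w x < 2 ^ m) ->
    all_digits q P w -> x < M ^ q ->
  [/\ all_digits q Q (rep_enc m M q E w x),
      word_le (num_word n w) (num_word n (rep_enc m M q E w x))
    & rep_dec m M q D (rep_enc m M q E w x) = x].
Proof.
move=> EDP E2m [w2m Pw] xM; set y := rep_enc m M q E w x.
have ydigit j : j < q ->
    digit (2 ^ m) y j = E (digit (2 ^ m) w j) (digit M x j).
  by move=> jq; rewrite from_digitsK.
have xdigit j : j < q -> digit M x j < M.
  move=> jq; rewrite ltn_mod; case: (M) xM => //.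
  by rewrite exp0n// (leq_ltn_trans _ jq).
have step j (jq : j < q) :=
  EDP (digit (2 ^ m) w j) (digit M x j) (Pw j jq) (xdigit j jq).
split.
- split=> [|j jq]; first by apply: from_digits_lt; rewrite ?expn_gt0.
  by rewrite ydigit//; case: (step j jq).
- apply: word_le_digits w2m _ => j jq.
  by rewrite ydigit//; case: (step j jq).
- rewrite -[RHS](digitK xM); apply: eq_bigr => -[j jq] _ /=.
  by rewrite ydigit//; case: (step j jq) => _ _ ->.
Qed.

(** Extends a typed encoder to all numbers; the default 0 outside its domain keeps every value below
    [2 ^ m]. *)
Definition num_enc m (P : pred (word m)) M (e : {w | P w} * 'I_M -> word m) w x :=
  if insub (num_word m w) is Some u then
    if insub x is Some i then word_num (e (u, i)) else 0
  else 0.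

Definition num_dec m (P : pred (word m)) M (d : {w | P w} -> 'I_M) w : nat :=
  if insub (num_word m w) is Some u then d u else 0.

Lemma num_enc_lt m (P : pred (word m)) M (e : {w | P w} * 'I_M -> word m) w x :
  num_enc e w x < 2 ^ m.
Proof.
rewrite /num_enc; case: insubP => [u _ _|_]; last by rewrite expn_gt0.
by case: insubP => [i _ _|_]; rewrite ?expn_gt0 ?word_num_lt.
Qed.

Lemma num_dec_lt m (P : pred (word m)) M (d : {w | P w} -> 'I_M) w :
  0 < M -> num_dec d w < M.
Proof. by move=> M0; rewrite /num_dec; case: insubP. Qed.

Lemma num_encE m (P : pred (word m)) M (e : {w | P w} * 'I_M -> word m)
    w x (Pw : P (num_word m w)) (xM : x < M) :
  num_word m (num_enc e w x) = e (Sub (num_word m w) Pw, Ordinal xM).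
Proof.
rewrite /num_enc; case: insubP => [u _ uw|/negP//].
case: insubP => [i _ ix|/negP//]; rewrite word_numK.
by congr (e (_, _)); apply: val_inj.
Qed.

Lemma is_write_num m M (P : pred (word m)) (e : {w | P w} * 'I_M -> word m)
    (d : image_of e -> 'I_M) :
    (forall w x, word_le (val w) (e (w, x))) ->
    (forall w x, d (to_image e (w, x)) = x) ->
  is_write M P (mem (codom e)) (num_enc e) (num_dec d).
Proof.
move=> e_le eK w x Pw xM; rewrite /num_dec num_encE; split.
- exact: codom_f.
- exact: (e_le (Sub (num_word m w) Pw)).
- case: insubP => [u _ uE|]; last by rewrite codom_f.
  rewrite (_ : u = to_image e (Sub (num_word m w) Pw, Ordinal xM)) ?eK//.
  exact: val_inj.
Qed.

Lemma computable_rep_enc k m (P : pred (word m)) M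
    (e : {w | P w} * 'I_M -> word m) N F G :
    0 < M -> computable k N -> computable k F -> computable k G ->
  computable k (fun xs => rep_enc m M (N xs) (num_enc e) (F xs) (G xs)).
Proof. by move=> *; apply: computable_map_digits; rewrite ?expn_gt0. Qed.

Lemma computable_rep_dec k m (P : pred (word m)) M (d : {w | P w} -> 'I_M) N F :
    computable k N -> computable k F ->
  computable k (fun xs => rep_dec m M (N xs) (num_dec d) (F xs)).
Proof.
move=> cN cF; apply: (@computable_map_digits _ (fun w _ => num_dec d w) _ 1
  _ _ _ _ _ _ cN cF (computable_const k 0)); by rewrite ?expn_gt0.
Qed.

Lemma word_le0 n (w : word n) : word_le (num_word n 0) w.
Proof. by apply/forallP => i; rewrite tnth_mktuple div0n. Qed.

(** Each of the [n %/ m] blocks carries a copy of [C0], and the remaining cells stay 0. The programs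
    hold [C0] as tables and compute the number of blocks from [n]. *)
Lemma repetition_code m M1 M2 M3 (C0 : wom3_code m 'I_M1 'I_M2 'I_M3) : 0 < m ->
  exists A : wom3_algorithm, forall n,
    exists C : wom3_code n 'I_(M1 ^ (n %/ m)) 'I_(M2 ^ (n %/ m)) 'I_(M3 ^ (n %/ m)),
      computes_code A C.
Proof.
move=> m0.
have M1_gt0 : 0 < M1 by have := Omega1_gt0 C0; rewrite card_ord.
have M2_gt0 : 0 < M2 by have := Omega2_gt0 C0; rewrite card_ord.
have M3_gt0 : 0 < M3 by have := Omega3_gt0 C0; rewrite card_ord.
(* The first write, like the others, starts from a known set of states: the
   all-zero word. *)
pose P0 : pred (word m) := pred1 (num_word m 0).
pose e1 (p : {w | P0 w} * 'I_M1) := enc1 C0 p.2.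
(* Every value of [e1] is one of [enc1 C0]; this recasts the argument for [dec1]. *)
have e1_in (w : image_of e1) : val w \in codom (enc1 C0).
  by case: w => w /= /codomP[p ->]; exact: codom_f.
pose d1 (w : image_of e1) := 
  dec1 C0 (exist (fun v => is_true (v \in codom (enc1 C0))) _ (e1_in w)).
have W1 : is_write M1 P0 (mem (codom (enc1 C0))) (num_enc e1) (num_dec d1).
  have/(_ e1 d1) H := @is_write_num m M1 P0.
  have {}H : is_write M1 P0 (mem (codom e1)) (num_enc e1) (num_dec d1).
    apply: H => [[w w0] x|w x].
      by rewrite [val _](eqP w0); exact: word_le0.
    by rewrite -[RHS](enc1K C0); congr dec1; apply: val_inj.
  move=> w x Pw xM; have [/codomP[p E] le eK] := H w x Pw xM.
  by split=> //; rewrite /= E; exact: codom_f.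
have W2 := is_write_num (@enc2_le _ _ _ _ C0) (@enc2K _ _ _ _ C0).
have W3 := is_write_num (@enc3_le _ _ _ _ C0) (@enc3K _ _ _ _ C0).
have cq k : computable k (fun xs => nth 0 xs 0 %/ m).
  by apply: computable_div => //; [exact: computable_nth|exact: computable_const].
have cs M : computable 1 (fun xs => M ^ (nth 0 xs 0 %/ m)).
  by apply: computable_exp => //; exact: computable_const.
have [s1 Hs1] := cs M1; have [s2 Hs2] := cs M2; have [s3 Hs3] := cs M3.
have [p1 Hp1] := computable_rep_enc e1 M1_gt0 (cq 2)
  (computable_const 2 0) (computable_nth 2 1).
have [p2 Hp2] := computable_rep_enc (enc2 C0) M2_gt0 (cq 3)
  (computable_nth 3 1) (computable_nth 3 2).
have [p3 Hp3] := computable_rep_enc (enc3 C0) M3_gt0 (cq 3)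
  (computable_nth 3 1) (computable_nth 3 2).
have [r1 Hr1] := computable_rep_dec d1 (cq 2) (computable_nth 2 1).
have [r2 Hr2] := computable_rep_dec (dec2 C0) (cq 2) (computable_nth 2 1).
have [r3 Hr3] := computable_rep_dec (dec3 C0) (cq 2) (computable_nth 2 1).
exists (WOM3Algorithm s1 s2 s3 p1 p2 p3 r1 r2 r3) => n; set q := n %/ m.
pose E1 (x : 'I_(M1 ^ q)) := num_word n (rep_enc m M1 q (num_enc e1) 0 x).
pose E2 (p : image_of E1 * 'I_(M2 ^ q)) := num_word n
  (rep_enc m M2 q (num_enc (enc2 C0)) (word_num (val p.1)) p.2).
pose E3 (p : image_of E2 * 'I_(M3 ^ q)) := num_word n
  (rep_enc m M3 q (num_enc (enc3 C0)) (word_num (val p.1)) p.2).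
have lt_dec M (P : pred (word m)) (d : {w | P w} -> 'I_M) w :
  0 < M -> rep_dec m M q (num_dec d) w < M ^ q.
  by move=> M0; apply: from_digits_lt => // j _; exact: num_dec_lt.
pose D1 (w : image_of E1) := Ordinal (lt_dec _ _ d1 (word_num (val w)) M1_gt0).
pose D2 (w : image_of E2) :=
  Ordinal (lt_dec _ _ (dec2 C0) (word_num (val w)) M2_gt0).
pose D3 (w : image_of E3) :=
  Ordinal (lt_dec _ _ (dec3 C0) (word_num (val w)) M3_gt0).
(* The blocks fit into [n] bits, so [num_word n] truncates nothing. *)
have Bq : (2 ^ m) ^ q <= 2 ^ n by rewrite -expnM leq_exp2l// mulnC leq_trunc_div.
have rep_encK M (P : pred (word m)) (e : {w | P w} * 'I_M -> word m) w x :
    word_num (num_word n (rep_enc m M q (num_enc e) w x)) =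
    rep_enc m M q (num_enc e) w x.
  rewrite num_wordK//; apply: leq_trans Bq; apply: from_digits_lt.
    by rewrite expn_gt0.
  by move=> j _; exact: num_enc_lt.
(* The states are followed through the writes: each image lies blockwise in the domain of the next
   block encoder. *)
have V0 : all_digits q P0 0.
  split=> [|j _]; first by rewrite !expn_gt0.
  by rewrite /P0 /digit div0n mod0n /= eqxx.
have S1 (x : 'I_(M1 ^ q)) :=
  is_write_rep n W1 (num_enc_lt e1) V0 (ltn_ord x).
have V1 (w : image_of E1) : all_digits q (mem (codom (enc1 C0))) (word_num (val w)).
  by case: w => w /= /codomP[x ->]; rewrite rep_encK; case: (S1 x).
have S2 (w : image_of E1) (x : 'I_(M2 ^ q)) :=
  is_write_rep n W2 (num_enc_lt (enc2 C0)) (V1 w) (ltn_ord x).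
have V2 (w : image_of E2) : all_digits q (mem (codom (enc2 C0))) (word_num (val w)).
  by case: w => w /= /codomP[[u x] ->]; rewrite rep_encK; case: (S2 u x).
have S3 (w : image_of E2) (x : 'I_(M3 ^ q)) :=
  is_write_rep n W3 (num_enc_lt (enc3 C0)) (V2 w) (ltn_ord x).
have E1K x : D1 (to_image E1 x) = x.
  by apply: val_inj; rewrite /= rep_encK; case: (S1 x).
have E2le w x : word_le (val w) (E2 (w, x)).
  by case: (S2 w x) => _; rewrite word_numK.
have E3le w x : word_le (val w) (E3 (w, x)).
  by case: (S3 w x) => _; rewrite word_numK.
have E2K w x : D2 (to_image E2 (w, x)) = x.
  by apply: val_inj; rewrite /= rep_encK; case: (S2 w x).
have E3K w x : D3 (to_image E3 (w, x)) = x.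
  by apply: val_inj; rewrite /= rep_encK; case: (S3 w x).
have q_gt0 M : 0 < M -> 0 < #|'I_(M ^ q)| by rewrite card_ord expn_gt0 => ->.
exists (WOM3Code (q_gt0 _ M1_gt0) (q_gt0 _ M2_gt0) (q_gt0 _ M3_gt0)
  E1K E2le E2K E3le E3K).
split=> /=.
- exact: Hs1.
- exact: Hs2.
- exact: Hs3.
- by move=> x; rewrite rep_encK; exact: Hp1.
- by move=> w x; rewrite rep_encK; exact: (Hp2 [:: n; _; _]).
- by move=> w x; rewrite rep_encK; exact: (Hp3 [:: n; _; _]).
- by move=> w; exact: Hr1.
- by move=> w; exact: Hr2.
- by move=> w; exact: Hr3.
Qed.

(** * Random colorings and binomial estimates *)

(** The left side consists of the first two terms of the binomial expansion of the right side. *)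
Lemma expSn_ge p n : p ^ n.+1 + n.+1 * p ^ n <= p.+1 ^ n.+1.
Proof.
elim: n => [|n IHn]; first by rewrite !expn1 expn0 addn1.
rewrite [leqRHS]expnS !expnS in IHn *; move: (p ^ n) (p.+1 ^ n) IHn => a b; nia.
Qed.

(** With [p = M.-1], [expSn_ge p p] gives [2 * p ^ p.+1 <= p.+1 ^ p.+1], that is,
    [(1 - 1/M) ^ M <= 1/2]. This is raised to the power [t], and the other factors use
    [M.-1 <= M]. *)
Lemma exp_pred_le M t s : 0 < M -> t * M <= s -> M.-1 ^ s * 2 ^ t <= M ^ s.
Proof.
case: M => //= p _ ps; rewrite -(subnKC ps) !expnD mulnAC leq_mul//.
  case: t ps => // t ps; rewrite [t.+1 * _]mulnC !expnM -expnMn leq_exp2r//.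
  apply: leq_trans (expSn_ge p p).
  by rewrite muln2 -addnn leq_add2l expnS leq_mul2r leqnSn orbT.
by have [->//|r0] := posnP (s - t * p.+1); rewrite leq_exp2r.
Qed.

(* A uniformly random coloring misses the color [c] on [S w] with probability
   at most [(1 - 1/M)^(t M) <= 2^-t]; then a union bound over [w] and [c]. *)
Lemma rainbow_coloring (Y W : finType) (S : W -> {set Y}) (P : pred W) M t :
    0 < M -> (forall w, P w -> t * M <= #|S w|) -> #|W| * M < 2 ^ t ->
  exists f : Y -> 'I_M, forall w c, P w -> exists2 y, y \in S w & f y = c.
Proof.
move=> M0 tS WM.
(* [family (F p)] consists of the colorings that miss the color [p.2] on [S p.1]. *)
pose F (p : W * 'I_M) y : pred 'I_M := [pred x | (y \in S p.1) ==> (x != p.2)].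
have bad_le p : P p.1 -> #|family (F p)| * 2 ^ t <= M ^ #|Y|.
  move=> Pw; have -> : #|family (F p)| = M.-1 ^ #|S p.1| * M ^ #|~: S p.1|.
    rewrite card_family foldrE big_map big_enum /=.
    rewrite (bigID (mem (S p.1))) /= -!prod_nat_const; congr (_ * _).
      apply: eq_bigr => y yS; rewrite -[M in RHS]card_ord -(cardC1 p.2).
      by apply: eq_card => x; rewrite !inE yS.
    apply: eq_big => [y|y yS]; first by rewrite inE.
    rewrite -[RHS]card_ord; apply: eq_card => x.
    by rewrite !inE (negPf yS).
  by rewrite mulnAC -(cardsC (S p.1)) expnD leq_mul2r exp_pred_le ?orbT ?tS.
have [f fP] : exists f : {ffun Y -> 'I_M}, forall p, P p.1 -> f \notin family (F p).
  have [/existsP[f /forallP fP]|] := boolP [exists f : {ffun Y -> 'I_M},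
      [forall p : W * 'I_M, P p.1 ==> (f \notin family (F p))]].
    by exists f => p; apply/implyP.
  rewrite negb_exists => /forallP all_bad; exfalso.
  (* If every coloring were bad for some pair, the families would cover all [M ^ #|Y|] of them,
     while [bad_le] bounds their total size. *)
  have : M ^ #|Y| * 2 ^ t <= #|W| * M * M ^ #|Y|; last first.
    by rewrite [_ * 2 ^ t]mulnC leq_pmul2r ?expn_gt0 ?M0// leqNgt WM.
  rewrite -[M in M ^ _ * _]card_ord -card_ffun -sum1_card.
  apply: (@leq_trans ((\sum_(p | P p.1) #|family (F p)|) * 2 ^ t)).
    rewrite leq_mul2r; apply/orP; right.
    under [leqRHS]eq_bigr do rewrite -sum1_card big_mkcond.
    rewrite exchange_big; apply: leq_sum => f _.
    have := all_bad f; rewrite negb_forall => /existsP[p].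
    by rewrite negb_imply negbK => /andP[Pw fp]; rewrite (bigD1 p)//= fp.
  rewrite big_distrl /= -[M in _ * M * _](card_ord M) -card_prod -sum_nat_const.
  by rewrite [leqRHS](bigID (fun p => P p.1)) /= -[leqLHS]addn0 leq_add// leq_sum.
exists f => w c Pw.
have [/exists_inP[y yS /eqP fy]|] := boolP [exists y in S w, f y == c].
  by exists y.
rewrite negb_exists_in => /forall_inP nf; case/negP: (fP (w, c) Pw).
by apply/familyP => y; apply/implyP => /nf.
Qed.

Lemma bin_le_exp2 n k : 'C(n, k) <= 2 ^ n.
Proof.
elim: n k => [|n IHn] [|k]; rewrite ?bin0 ?expn_gt0//.
by rewrite binS expnS mul2n -addnn leq_add.
Qed.

(* In the binomial expansion of [(a + 1) ^ n] with [n = (a + 1) m], the term of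
   index [m] is the largest. *)
Lemma exp_le_bin a m : a.+1 ^ (a.+1 * m) <=
  (a.+1 * m).+1 * ('C(a.+1 * m, m) * a ^ (a.+1 * m - m)).
Proof.
set n := a.+1 * m; pose T k := 'C(n, k) * a ^ (n - k).
have mn : m <= n by rewrite /n; nia.
(* The ratio of consecutive terms, cross-multiplied: [(n - k) / (k.+1 * a)] is at least 1 for
   [k < m] and at most 1 from [m] on. *)
have TS k : k < n -> k.+1 * T k.+1 * a = (n - k) * T k.
  by move=> kn; rewrite /T mulnA mul_bin_left -!mulnA -expnSr subnSK.
suff Tmax k : k <= n -> T k <= T m.
  apply: (@leq_trans (\sum_(i < n.+1) T m)); last by rewrite sum_nat_const card_ord.
  rewrite -[in leqLHS]addn1 expnDn.
  by apply: leq_sum => i _; rewrite exp1n muln1 Tmax// -ltnS.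
have Tup i : i < m -> T i <= T i.+1.
  move=> im; have i_n : i < n by apply: leq_trans mn.
  have ni : 0 < n - i by rewrite subn_gt0.
  rewrite -(leq_pmul2l ni) -TS// mulnAC leq_mul2r; apply/orP; right.
  by rewrite /n; nia.
have Tdown i : m <= i -> i < n -> T i.+1 <= T i.
  move=> mi i_n; have [a0|a0] := posnP a; first by move: i_n; rewrite /n a0; lia.
  have ia : 0 < i.+1 * a by rewrite muln_gt0 a0.
  rewrite -(leq_pmul2l ia) mulnAC TS// leq_mul2r; apply/orP; right.
  by rewrite /n; nia.
have [mk kn|km _] := leqP m k.
  elim: k mk kn => [|k IHk] mk kn; first by move: mk; rewrite leqn0 => /eqP->.
  move: mk; rewrite leq_eqVlt => /predU1P[->//|mk].
  by apply: leq_trans (Tdown k mk kn) (IHk mk (ltnW kn)).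
have : forall d, d <= m -> T (m - d) <= T m.
  elim=> [|d IHd] dm; first by rewrite subn0.
  apply: leq_trans (IHd (ltnW dm)).
  by rewrite -[m - d]subnSK// Tup// ltn_subrL; lia.
by move=> /(_ (m - k) (leq_subr _ _)); rewrite subKn// ltnW.
Qed.

(** * The block code *)

Definition supp n (w : word n) : {set 'I_n} := [set i | tnth w i].

Definition word_of n (A : {set 'I_n}) : word n := [tuple i \in A | i < n].

Lemma word_ofK n : cancel (@word_of n) (@supp n).
Proof. by move=> A; apply/setP => i; rewrite inE tnth_mktuple. Qed.

Lemma word_le_supp n (w y : word n) : word_le w y = (supp w \subset supp y).
Proof.
apply/forallP/subsetP => [wy i|wy i].
  by rewrite !inE; exact/implyP.
by have := wy i; rewrite !inE => /implyP.
Qed.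

(** Joining different sets of [D] to [supp w] gives different successors, because removing [supp w]
    recovers the set. *)
Lemma card_word_above n (w : word n) (D : {set {set 'I_n}}) :
    {in D, forall A : {set 'I_n}, A \subset ~: supp w} ->
  #|D| <= #|[set y : word n | word_le w y & supp y :\: supp w \in D]|.
Proof.
move=> Dw; have DU A : A \in D -> (supp w :|: A) :\: supp w = A.
  move=> /Dw Aw; rewrite setDUl setDv set0U; apply/setDidPl.
  by rewrite disjoints_subset.
rewrite -(card_in_imset (f := fun A => word_of (supp w :|: A))).
  apply/subset_leq_card/subsetP => _ /imsetP[A AD ->].
  by rewrite inE word_le_supp word_ofK subsetUl DU.
move=> A B /DU AE /DU BE /(can_inj (@word_ofK n)) AB.
by rewrite -AE -BE AB.
Qed.

(** The first write stores a [k1]-subset directly. The second adds [k2] cells and the third any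
    cells; both are decoded by rainbow colorings, and [(2 * n).+1] is the exponent [t] of the union
    bound. *)
Lemma random_code n k1 k2 M2 M3 :
    k1 <= n -> 0 < M2 -> 0 < M3 ->
    (2 * n).+1 * M2 <= 'C(n - k1, k2) -> (2 * n).+1 * M3 <= 2 ^ (n - k1 - k2) ->
  inhabited (wom3_code n 'I_('C(n, k1)) 'I_M2 'I_M3).
Proof.
move=> kn M2_gt0 M3_gt0 le2 le3.
(* There are [2 ^ n] words and at most [2 ^ n] colors, so the number of pairs is below
   [2 ^ (2 * n).+1]. *)
have color M (S : word n -> {set word n}) (P : pred (word n)) :
    0 < M -> (forall w, P w -> (2 * n).+1 * M <= #|S w|) -> (2 * n).+1 * M <= 2 ^ n ->
    exists f : word n -> 'I_M, forall w c, P w -> exists2 y, y \in S w & f y = c.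
  move=> M0 MS Mn; apply: (rainbow_coloring M0 MS).
  rewrite card_tuple card_bool expnS [2 ^ (2 * n)](_ : _ = 2 ^ n * 2 ^ n); last first.
    by rewrite -expnD addnn mul2n.
  have := leq_trans (leq_pmull M (ltn0Sn (2 * n))) Mn.
  have: 0 < 2 ^ n by rewrite expn_gt0.
  by move: (2 ^ n) => N N0 MN; clear -N0 MN; nia.
pose U1 : {set {set 'I_n}} := [set A : {set 'I_n} | #|A| == k1].
have cardU1 : #|U1| = 'C(n, k1) by rewrite card_draws card_ord.
pose S2 (w : word n) := [set y : word n | word_le w y &
  supp y :\: supp w \in [set A : {set 'I_n} | A \subset ~: supp w & #|A| == k2]].
pose S3 (w : word n) := [set y : word n | word_le w y &
  supp y :\: supp w \in powerset (~: supp w)].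
have [|||f2 f2P] := color M2 S2 (fun w => #|supp w| == k1) => //.
- move=> w /eqP wk; apply: leq_trans le2 (leq_trans _ (card_word_above _)) => //.
    by rewrite cards_draws cardsCs setCK card_ord wk.
  by move=> A; rewrite inE => /andP[].
- exact: leq_trans le2 (leq_trans (bin_le_exp2 _ _) (leq_pexp2l _ (leq_subr _ _))).
have [|||f3 f3P] := color M3 S3 (fun w => #|supp w| == k1 + k2) => //.
- move=> w /eqP wk; apply: leq_trans le3 (leq_trans _ (card_word_above _)) => //.
    by rewrite card_powerset cardsCs setCK card_ord wk subnDA.
  by move=> A; rewrite powersetE.
- by apply: leq_trans le3 _; rewrite leq_pexp2l// -subnDA leq_subr.
rewrite -cardU1.
pose e1 (x : 'I_#|U1|) : word n := word_of (enum_val x).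
have e1_inj : injective e1.
  exact: inj_comp (can_inj (@word_ofK n)) enum_val_inj.
have e1_card (w : image_of e1) : #|supp (val w)| == k1.
  case: w => w /= /codomP[x ->]; rewrite word_ofK.
  by have := enum_valP x; rewrite inE.
pose d1 (w : image_of e1) := iinv (valP w).
(* The encoder picks a successor whose color is the message, so the color decodes it. *)
have ex2 (p : image_of e1 * 'I_M2) : exists y, (y \in S2 (val p.1)) && (f2 y == p.2).
  by have [y yS <-] := f2P (val p.1) p.2 (e1_card p.1); exists y; rewrite yS eqxx.
pose e2 p : word n := xchoose (ex2 p).
have e2P p : e2 p \in S2 (val p.1) /\ f2 (e2 p) = p.2.
  by have /andP[? /eqP] := xchooseP (ex2 p).
(* The third coloring is guaranteed only above words of weight [k1 + k2]. *)
have e2_card (w : image_of e2) : #|supp (val w)| == k1 + k2.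
  case: w => w /= /codomP[p ->]; have [] := e2P p.
  rewrite !inE word_le_supp => /and3P[le _ /eqP ck] _.
  by rewrite -(cardsID (supp (val p.1))) ck (setIidPr le) (eqP (e1_card _)).
have ex3 (p : image_of e2 * 'I_M3) : exists y, (y \in S3 (val p.1)) && (f3 y == p.2).
  by have [y yS <-] := f3P (val p.1) p.2 (e2_card p.1); exists y; rewrite yS eqxx.
pose e3 p : word n := xchoose (ex3 p).
have e3P p : e3 p \in S3 (val p.1) /\ f3 (e3 p) = p.2.
  by have /andP[? /eqP] := xchooseP (ex3 p).
split; apply: (@WOM3Code _ _ _ _ e1 e2 e3
  d1 (fun w => f2 (val w)) (fun w => f3 (val w))).
- by rewrite card_ord cardU1 bin_gt0.
- by rewrite card_ord.
- by rewrite card_ord.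
- by move=> x; apply: e1_inj; rewrite /d1 f_iinv.
- by move=> w x; have [] := e2P (w, x); rewrite inE => /andP[].
- by move=> w x; have [] := e2P (w, x).
- by move=> w x; have [] := e3P (w, x); rewrite inE => /andP[].
- by move=> w x; have [] := e3P (w, x).
Qed.

Lemma leq_double_divn d x : 0 < d -> d <= x -> x <= 2 * d * (x %/ d).
Proof.
move=> d0 dx; have := ltn_ceil x d0; have : 0 < x %/ d by rewrite divn_gt0.
nia.
Qed.

(** The bound on [3 ^ (3 * m)] from [exp_le_bin 2 m] is inserted into [exp_le_bin 3 m]. Each of [M2]
    and [M3] costs a factor [t] for the coloring and 2 for rounding down. *)
Lemma balanced_code m (n := 4 * m) (t := (2 * n).+1) :
    t <= 'C(3 * m, m) -> t <= 2 ^ (2 * m) ->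
  exists M1 M2 M3 (_ : wom3_code n 'I_M1 'I_M2 'I_M3),
    2 ^ (8 * m) <= n.+1 * (3 * m).+1 * (2 * t) ^ 2 * (M1 * M2 * M3).
Proof.
move=> t2 t3; pose M2 := 'C(3 * m, m) %/ t; pose M3 := 2 ^ (2 * m) %/ t.
have n1 : n - m = 3 * m by rewrite /n; lia.
have n2 : n - m - m = 2 * m by rewrite /n; lia.
have [|||||C] := @random_code n m m M2 M3.
- by rewrite /n; lia.
- by rewrite divn_gt0.
- by rewrite divn_gt0.
- by rewrite n1 mulnC leq_trunc_div.
- by rewrite n2 mulnC leq_trunc_div.
exists 'C(n, m), M2, M3, C.
have le2 : 'C(3 * m, m) <= 2 * t * M2 by exact: leq_double_divn.
have le3 : 2 ^ (2 * m) <= 2 * t * M3 by exact: leq_double_divn.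
have := exp_le_bin 3 m; have := exp_le_bin 2 m.
rewrite -/n n1 (_ : 3 * m - m = 2 * m); last by lia.
rewrite (_ : 2 ^ (8 * m) = 4 ^ n); last by rewrite /n -[4]/(2 ^ 2) -expnM mulnA.
move=> H3 H4; apply: leq_trans H4 _.
rewrite -!mulnA leq_mul2l; apply/orP; right.
rewrite [leqRHS](_ : _ = 'C(n, m) * ((3 * m).+1 * ((2 * t * M2) * (2 * t * M3)))).
  by rewrite leq_mul2l; apply/orP; right; apply: leq_trans H3 _;
     rewrite leq_mul2l leq_mul ?orbT.
ring.
Qed.

(* [m] stays a variable so that the powers of 2 are never computed in unary. *)
Lemma block_code m : m = 64 ->
  exists M1 M2 M3 (_ : wom3_code (4 * m) 'I_M1 'I_M2 'I_M3),
    2 ^ (8 * m - 39) <= M1 * M2 * M3.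
Proof.
move=> m64; set t := (2 * (4 * m)).+1.
have t10 : t <= 2 ^ 10 by rewrite /t m64.
have t2 : t <= 'C(3 * m, m).
  apply: leq_trans t10 _.
  have H := exp_le_bin 2 m; rewrite [3 * m - m](_ : _ = 2 * m) in H; last lia.
  (* Since [2 ^ 4 <= 3 ^ 3] and [193 <= 2 ^ 8], the binomial is at least [2 ^ (2 * m - 8)], far
     above [2 ^ 10]. *)
  have {}H : 2 ^ (4 * m) <= 2 ^ 8 * ('C(3 * m, m) * 2 ^ (2 * m)).
    apply: leq_trans (leq_trans H _).
      by rewrite !expnM leq_exp2r// m64.
    by apply: leq_mul => //; rewrite m64.
  rewrite (_ : 4 * m = 8 + (10 + (2 * m + (2 * m - 18)))) in H; last lia.
  rewrite 2!expnD leq_pmul2l ?expn_gt0// in H.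
  have m0 : 0 < 2 ^ (2 * m) by rewrite expn_gt0.
  rewrite -(leq_pmul2r m0); apply: leq_trans H.
  by rewrite leq_pmul2l ?expn_gt0// leq_pexp2l// leq_addr.
have t3 : t <= 2 ^ (2 * m).
  by apply: leq_trans t10 _; rewrite leq_exp2l// m64.
have [M1 [M2 [M3 [C MC]]]] := balanced_code t2 t3.
exists M1, M2, M3, C; rewrite -(@leq_pmul2l (2 ^ 39)) ?expn_gt0// -expnD.
rewrite subnKC; last lia.
apply: leq_trans MC _; rewrite leq_mul2r; apply/orP; right.
(* The 39 lost bits: [257 <= 2 ^ 9], [193 <= 2 ^ 8] and [(2 * t) ^ 2 <= 2 ^ 22]. *)
rewrite -[39]/(9 + 8 + 22) 2!expnD; apply: leq_mul.
  by apply: leq_mul; rewrite m64.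
rewrite (expnM 2 11 2) leq_exp2r//.
by rewrite (expnD 2 1 10) leq_mul2l t10.
Qed.

(** * The rate of the repeated code *)

Import Order.TTheory GRing.Theory Num.Theory.

Local Open Scope ring_scope.

Theorem theorem1p2 (R : realType) (eps : R) (eps_gt0 : 0 < eps) :
  exists (N : nat) (A : wom3_algorithm), forall n : nat, (N < n)%N ->
    exists (m1 m2 m3 : nat) (C : wom3_code n 'I_m1 'I_m2 'I_m3),
      computes_code A C /\ 1809%:R / 1000%:R - eps < rate R C.
Proof.
have [m m64] : exists m, m = 64%N by exists 64%N.
have [M1 [M2 [M3 [C0 M_ge]]]] := block_code m64.
have M_gt0 : (0 < M1 * M2 * M3)%N by apply: leq_trans M_ge; rewrite expn_gt0.
have m0 : (0 < 4 * m)%N by rewrite m64.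
have [A AP] := repetition_code C0 m0.
(* With [q >= 50] blocks and [n < 256 * q.+1], the rate is at least [473/256 * 50/51 > 1.811]. *)
exists (50 * (4 * m))%N, A => n n_gt; have [C AC] := AP n.
do 3!eexists; exists C; split=> //.
rewrite /rate !card_ord; set q := (n %/ (4 * m))%N in C AC *.
have q50 : (50 <= q)%N by rewrite leq_divRL// ltnW.
have nq : (n < 256 * q.+1)%N.
  by have := ltn_ceil n m0; rewrite -/q {1}m64 mulnC.
have ln2_gt0 : 0 < ln 2 :> R by rewrite ln_gt0// ltr1n.
move: M_gt0; rewrite !muln_gt0 => /andP[/andP[M1_gt0 M2_gt0] M3_gt0].
(* Here [473 = 8 * 64 - 39]. *)
have log2M : 473%:R <= (log2 M1%:R + log2 M2%:R + log2 M3%:R : R).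
  rewrite /log2 -!mulrDl ler_pdivlMr// -!lnM ?posrE ?ltr0n ?mulr_gt0 ?ltr0n//.
  rewrite [leLHS]mulr_natl -lnXn ?ltr0n// ler_ln ?posrE ?exprn_gt0 ?mulr_gt0 ?ltr0n//.
  by rewrite -natrX -!natrM ler_nat; move: M_ge; rewrite {1}m64.
have log2X M : (0 < M)%N -> log2 (M ^ q)%N%:R = q%:R * log2 M%:R :> R.
  by move=> M0; rewrite /log2 natrX lnXn ?ltr0n// mulrA mulr_natl.
rewrite !log2X// -!mulrDr.
have n0 : 0 < n%:R :> R by rewrite ltr0n; exact: leq_ltn_trans n_gt.
rewrite ltr_pdivlMr//.
have q50R : 50%:R <= q%:R :> R by rewrite ler_nat.
have nqR : n%:R <= 256%:R * (q%:R + 1) :> R.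
  by rewrite natr1 -natrM ler_nat ltnW.
nra.
Qed.
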